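(* Let $G$ be a locally compact, second countable group. Assume that $d_1$ and $d_2$ are plig metrics on $G$. Then the identity map $\operatorname{Id}:(G,d_1)\rightarrow (G,d_2)$ is a coarse equivalence.
   Context: Topological groups are assumed Hausdorff; $G$ is locally compact if every point has a relatively compact neighbourhood. A plig metric on a topological group $G$ is a metric $d$ on $G$ which is: proper (all closed $d$-bounded subsets of $G$ are compact), left invariant ($d(gx,gy)=d(x,y)$ for all $g,x,y\in G$), and generates the given topology of $G$ (the metric topology of $d$ coincides with the topology of $G$). Let $(X,d_X)$ and $(Y,d_Y)$ be metric spaces. A map $f:X\to Y$ is uniformly expansive if for every $R>0$ there is $S>0$ such that $d_X(x,x')\le R$ implies $d_Y(f(x),f(x'))\le S$. It is metrically proper if $f^{-1}(B)$ is bounded in $X$ for every bounded $B\subset Y$. It is a coarse map if it is both uniformly expansive and metrically proper. Two coarse maps $h_0,h_1:X\to Y$ are coarsely equivalent, written $h_0\sim_c h_1$, if there is $C>0$ with $d_Y(h_0(x),h_1(x))<C$ for all $x\in X$. A coarse map $f:X\to Y$ is a coarse equivalence if there is a coarse map $g:Y\to X$ with $f\circ g\sim_c \operatorname{Id}_Y$ and $g\circ f\sim_c\operatorname{Id}_X$. *)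

(* Defs.v *)
From HB Require Import structures.
From mathcomp Require Import all_boot all_order all_algebra.
From mathcomp Require Import all_classical all_reals all_analysis.

Set Implicit Arguments.
Unset Strict Implicit.
Unset Printing Implicit Defensive.

Import Order.TTheory GRing.Theory Num.Theory.

Local Open Scope classical_set_scope.
Local Open Scope ring_scope.

(* Hausdorffness is not part of the structure. *)
HB.structure Definition PreTopologicalGroup := {G of Topological G & Group G}.

HB.mixin Record PreTopologicalGroup_isTopologicalGroup G
    & PreTopologicalGroup G := {
  mulg_continuous : continuous (fun x : G * G => (x.1 * x.2)%g);
  invg_continuous : continuous (fun x : G => (x^-1)%g)
}.

#[short(type="topologicalGroupType")]
HB.structure Definition TopologicalGroup :=
  {G of PreTopologicalGroup G & PreTopologicalGroup_isTopologicalGroup G}.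

(* Metrics as first-class objects, so that one type can carry several. *)
Record metric (R : realType) (X : Type) := Metric {
  metric_fun :> X -> X -> R;
  metric_refl : forall x, metric_fun x x = 0;
  metric_separated : forall x y, metric_fun x y = 0 -> x = y;
  metric_symmetric : forall x y, metric_fun x y = metric_fun y x;
  metric_trans : forall y x z,
    metric_fun x z <= metric_fun x y + metric_fun y z
}.

(* The metric space (X, d).  It forgets any topology X may already have: its
   topology is the one induced by d. *)
Definition metrized (R : realType) (X : choiceType) (d : metric R X) : Type := X.

HB.instance Definition _ (R : realType) (X : choiceType) (d : metric R X) :=
  Choice.copy (metrized d) X.
HB.instance Definition _ (R : realType) (X : choiceType) (d : metric R X) :=
  @isMetric.Build R (metrized d) d (metric_refl d) (@metric_separated R X d)
    (metric_symmetric d) (metric_trans d).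

(* The library's bounded_set is about norms; this is the metric notion. *)
Definition mbounded (R : realType) (X : metricType R) (A : set X) : Prop :=
  exists M : R, forall x y, A x -> A y -> mdist x y <= M.

Definition proper_metric_space (R : realType) (X : metricType R) : Prop :=
  forall A : set X, closed A -> mbounded A -> compact A.

Definition left_invariant (R : realType) (G : groupType) (d : G -> G -> R) :
    Prop :=
  forall g x y : G, d (g * x)%g (g * y)%g = d x y.

Definition generates_topology (R : realType) (X : topologicalType)
    (d : metric R X) : Prop :=
  forall A : set X, open (A : set (metrized d)) <-> open A.

Definition plig (R : realType) (G : topologicalGroupType) (d : metric R G) :
    Prop :=
  [/\ proper_metric_space (metrized d), left_invariant d
    & generates_topology d].

Definition uniformly_expansive (R : realType) (X Y : metricType R)
    (f : X -> Y) : Prop :=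
  forall r : R, 0 < r -> exists2 s : R, 0 < s &
    forall x x' : X, mdist x x' <= r -> mdist (f x) (f x') <= s.

Definition metrically_proper (R : realType) (X Y : metricType R)
    (f : X -> Y) : Prop :=
  forall B : set Y, mbounded B -> mbounded (f @^-1` B).

Definition coarse_map (R : realType) (X Y : metricType R) (f : X -> Y) : Prop :=
  uniformly_expansive f /\ metrically_proper f.

Definition coarsely_equivalent (R : realType) (X Y : metricType R)
    (h0 h1 : X -> Y) : Prop :=
  exists2 C : R, 0 < C & forall x : X, mdist (h0 x) (h1 x) < C.

Definition coarse_equivalence (R : realType) (X Y : metricType R)
    (f : X -> Y) : Prop :=
  coarse_map f /\
  exists g : Y -> X,
    [/\ coarse_map g, coarsely_equivalent (f \o g) idfun
      & coarsely_equivalent (g \o f) idfun].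

(* Main.v *)
Require Import Defs.
From mathcomp Require Import all_boot all_order all_algebra.
From mathcomp Require Import all_classical all_reals all_analysis.

Import Order.TTheory GRing.Theory Num.Theory.
Import numFieldNormedType.Exports.

Local Open Scope classical_set_scope.
Local Open Scope ring_scope.

(** Everything reduces to one fact: a closed ball of [d1] about the identity
    lies in some closed ball of [d2] about the identity ([plig_ball_bounded]).  Such a ball is compact
    because [d1] is proper, and the distance to the identity for [d2] is a
    continuous function on it because both metrics induce the topology of the
    group ([same_topology_continuous]), so that function is bounded.

    Left invariance moves this bound from the identity to every other point:
    the distance from [x] to [y] is the distance from the identity to
    [x^-1 * y], for both metrics.  Hence the identity map is uniformly
    expansive from [d1] to [d2] ([plig_uniformly_expansive]) and, by symmetry,
    from [d2] to [d1].  A map with a uniformly expansive left inverse is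
    metrically proper ([left_inverse_metrically_proper]), so the identity is a
    coarse map in both directions, and the two maps are inverse to each other
    on the nose. *)

Lemma mdist_continuous (R : realType) (X : metricType R) (a : X) :
  continuous (mdist a : X -> R).
Proof.
move=> x; apply/cvgrPdist_lt => e e0; near=> y.
have xy : mdist x y < e.
  near: y; have := nbhsx_ballx x e e0; apply: filterS => y.
  by rewrite ballEmdist.
apply: le_lt_trans xy.
rewrite ler_norml; apply/andP; split.
  by rewrite lerNl opprB lerBlDl metric_triangle.
by rewrite lerBlDr addrC [mdist x y]metric_sym metric_triangle.
Unshelve. all: by end_near. Qed.

Lemma closed_mball (R : realType) (X : metricType R) (a : X) (r : R) :
  closed [set x | mdist a x <= r].
Proof.
apply: (@closed_comp _ _ (mdist a : X -> R) [set z | z <= r]).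
  by move=> x _; exact: mdist_continuous.
exact: closed_le.
Qed.

Lemma mbounded_mball (R : realType) (X : metricType R) (a : X) (r : R) :
  mbounded [set x | mdist a x <= r].
Proof.
exists (r + r) => x y /= ax ay.
by rewrite (le_trans (metric_triangle x a y))// lerD// metric_sym.
Qed.

Lemma same_topology_continuous (R : realType) (X : topologicalType)
    (d1 d2 : metric R X) :
  generates_topology d1 -> generates_topology d2 ->
  continuous (fun x : metrized d1 => x : metrized d2).
Proof.
by move=> top1 top2; apply/continuousP => A /top2 oA; apply/top1.
Qed.

(** The real-valued function [mdist a] is what gets bounded on the compact
    ball, which avoids extracting a finite subcover by [d2]-balls. *)
Lemma plig_ball_bounded {R : realType} {G : topologicalGroupType}
    {d1 d2 : metric R G} (r : R) : plig d1 -> plig d2 ->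
  exists2 s : R, 0 < s & forall x : G, d1 1%g x <= r -> d2 1%g x <= s.
Proof.
move=> [proper1 _ top1] [_ _ top2].
pose B := [set x : metrized d1 | mdist (1%g : metrized d1) x <= r].
have cptB : compact B.
  by apply: proper1; [exact: closed_mball | exact: mbounded_mball].
pose f (x : metrized d1) : R := mdist (1%g : metrized d2) (x : metrized d2).
have fcont : continuous f.
  move=> x; apply: (@continuous_comp (metrized d1) (metrized d2) R id).
    exact: same_topology_continuous.
  exact: mdist_continuous.
have /compact_bounded [M [_ boundM]] : compact (f @` B).
  apply: continuous_compact cptB.
  by apply: continuous_subspaceT => x; exact: fcont.
(* The bounds of a [bounded_set] are the numbers strictly above [M], and [s]
   has to be positive. *)
exists (Num.max M 0 + 1); first by rewrite ltr_wpDl// le_max lexx orbT.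
move=> x xr; apply: le_trans (ler_norm _) _.
apply: boundM; last by exists x.
by rewrite (@le_lt_trans _ _ (Num.max M 0)) ?ltrDl// le_max lexx.
Qed.

Lemma left_invariant_dist1 {R : realType} {G : groupType} {d : G -> G -> R} :
  left_invariant d -> forall x y : G, d x y = d 1%g (x^-1 * y)%g.
Proof. by move=> linv x y; rewrite -(linv x^-1%g x y) mulVg. Qed.

Lemma plig_uniformly_expansive {R : realType} {G : topologicalGroupType}
    {d1 d2 : metric R G} : plig d1 -> plig d2 ->
  uniformly_expansive (fun x : metrized d1 => x : metrized d2).
Proof.
move=> plig1 plig2 r _; have [s s0 ball12] := plig_ball_bounded r plig1 plig2.
have [_ linv1 _] := plig1; have [_ linv2 _] := plig2.
exists s => // x y; change (d1 x y <= r -> d2 x y <= s).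
by rewrite (left_invariant_dist1 linv1) (left_invariant_dist1 linv2);
  exact: ball12.
Qed.

Lemma left_inverse_metrically_proper (R : realType) (X Y : metricType R)
    (f : X -> Y) (g : Y -> X) :
  cancel f g -> uniformly_expansive g -> metrically_proper f.
Proof.
move=> fK gexp B [M boundM].
(* Uniform expansiveness speaks of positive radii, and [M] may be negative
   when [B] is empty. *)
have [|s _ gs] := gexp (Num.max M 0 + 1).
  by rewrite ltr_wpDl// le_max lexx orbT.
exists s => x y Bx By; rewrite -[x]fK -[y]fK; apply: gs.
by rewrite (le_trans (boundM _ _ Bx By))// ler_wpDr// le_max lexx.
Qed.

Lemma plig_coarse_map (R : realType) (G : topologicalGroupType)
    (d1 d2 : metric R G) : plig d1 -> plig d2 ->
  coarse_map (fun x : metrized d1 => x : metrized d2).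
Proof.
move=> plig1 plig2; split; first exact: plig_uniformly_expansive.
by apply: left_inverse_metrically_proper (plig_uniformly_expansive plig2 plig1).
Qed.

Lemma coarsely_equivalent_refl (R : realType) (X Y : metricType R)
    (h : X -> Y) : coarsely_equivalent h h.
Proof. by exists 1 => // x; rewrite mdistxx. Qed.

Theorem theorem2p8 (R : realType) (G : topologicalGroupType)
    (hausG : hausdorff_space G) (lcG : locally_compact [set: G])
    (scG : @second_countable G) (d1 d2 : metric R G)
    (plig1 : plig d1) (plig2 : plig d2) :
  coarse_equivalence (fun x : metrized d1 => x : metrized d2).
Proof.
split; first exact: plig_coarse_map.
exists (fun x : metrized d2 => x : metrized d1).
by split; [exact: plig_coarse_map | exact: coarsely_equivalent_refl..].
Qed.
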